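(* Let $C_n$ be the cycle graph on $n$ vertices and let $I(C_n^2)$ be the edge ideal of the square of $C_n$. Then $$\mathrm{v}(I(C_n^2))=\begin{cases}\lfloor \frac{n-5}6\rfloor+1, & \text{if } n\equiv 0,5 \pmod 6,\\ \lfloor \frac{n-5}6\rfloor+2, & \text{otherwise.}\end{cases}$$
   Context: The square $G^2$ of a simple graph $G$ is the graph on the same vertex set in which two distinct vertices are adjacent iff their distance in $G$ is at most $2$. For a simple graph $H$ with vertices $x_1,\dots,x_n$, its edge ideal is $I(H)=(x_ix_j : \{x_i,x_j\}\in E(H))\subseteq S=K[x_1,\dots,x_n]$, $K$ a field. The v-number: for a graded ideal $I$ of the standard graded polynomial ring $S$ with $\mathfrak m$ the ideal generated by all variables, $\mathrm{v}(I)=\min\{d\ge 1 : \text{there exist } f\in S_d \text{ and } \mathfrak p\in \mathrm{Ass}(I) \text{ with } (I:f)=\mathfrak p\}$ if $I\subsetneq\mathfrak m$, and $\mathrm{v}(\mathfrak m)=0$. Here $S_d$ is the degree-$d$ component and $\mathrm{Ass}(I)$ is the set of associated primes of $S/I$. *)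

(* Defs.v *)
From HB Require Import structures.
From mathcomp Require Import all_boot all_order all_algebra.
From mathcomp Require Import mpoly.
From mathcomp Require Import classical_sets.

Set Implicit Arguments.
Unset Strict Implicit.
Unset Printing Implicit Defensive.

Import GRing.Theory.

Local Open Scope ring_scope.
Local Open Scope classical_set_scope.

Record sgraph (T : finType) := SGraph {
  adj :> rel T;
  adj_sym : ssrbool.symmetric adj;
  adj_irr : irreflexive adj }.

Section Distance.
Variables (T : finType) (G : sgraph T).

(* The distance is at most d iff some walk has at most d edges; a walk from x
   to y is x followed by its other vertices, so its length is the tuple size. *)
Definition dist_le (d : nat) (x y : T) : bool :=
  [exists m : 'I_d.+1, [exists p : m.-tuple T, path G x p && (last x p == y)]].

Lemma dist_leP d x y :
  reflect (exists p : seq T, [/\ path G x p, last x p = y & (size p <= d)%N])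
          (dist_le d x y).
Proof.
apply: (iffP existsP) => [[m /existsP[p /andP[Gp /eqP px]]]|[p [Gp px sp]]].
  by exists p; split=> //; rewrite size_tuple -ltnS.
exists (Ordinal (sp : (size p < d.+1)%N)); apply/existsP; exists (in_tuple p).
by rewrite /= Gp px eqxx.
Qed.

Lemma dist_le_sym d : ssrbool.symmetric (dist_le d).
Proof.
suff H x y : dist_le d x y -> dist_le d y x.
  by move=> x y; apply/idP/idP; apply: H.
move=> /dist_leP[p [Gp <- sp]]; apply/dist_leP.
exists (rev (belast x p)); split; last by rewrite size_rev size_belast.
  by rewrite rev_path (eq_path (e' := G)) // => u v /=; rewrite adj_sym.
by case: p {Gp sp} => //= z p; rewrite rev_cons last_rcons.
Qed.

Definition square_adj : rel T := [rel x y | (x != y) && dist_le 2 x y].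

Lemma square_adj_sym : ssrbool.symmetric square_adj.
Proof. by move=> x y; rewrite /square_adj /= eq_sym dist_le_sym. Qed.

Lemma square_adj_irr : irreflexive square_adj.
Proof. by move=> x; rewrite /square_adj /= eqxx. Qed.

Definition square : sgraph T := SGraph square_adj_sym square_adj_irr.
End Distance.

(* ordS is the successor modulo n; the graph is the n-cycle when 3 <= n. *)
Definition cycle_adj (n : nat) : rel 'I_n :=
  [rel i j | (i != j) && ((j == ordS i) || (i == ordS j))].

Lemma cycle_adj_sym n : ssrbool.symmetric (@cycle_adj n).
Proof. by move=> i j; rewrite /cycle_adj /= eq_sym orbC. Qed.

Lemma cycle_adj_irr n : irreflexive (@cycle_adj n).
Proof. by move=> i; rewrite /cycle_adj /= eqxx. Qed.

Definition cycle_graph (n : nat) : sgraph 'I_n :=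
  SGraph (@cycle_adj_sym n) (@cycle_adj_irr n).

Section Ideals.
Variables (K : fieldType) (n : nat).
Local Notation S := {mpoly K[n]}.
Implicit Types (I p : set S) (f g : S) (d : nat).

(* idealr_closed requires 1 \notin J: when no proper ideal contains A, the
   intersection below is over the empty family and gives the unit ideal. *)
Definition ideal_gen (A : set S) : set S :=
  smallest (fun J : set S => idealr_closed (mem J)) A.

Definition irrelevant_ideal : set S := ideal_gen (range (fun i : 'I_n => 'X_i)).

Definition edge_ideal (H : sgraph 'I_n) : set S :=
  ideal_gen [set f | exists i j : 'I_n, H i j /\ f = 'X_i * 'X_j].

Definition colon I f : set S := [set g | I (g * f)].

(* colon I g is the annihilator of the class of g in S / I. *)
Definition Ass I : set (set S) :=
  [set p | [/\ idealr_closed (mem p), prime_idealr_closed (mem p)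
             & exists g, p = colon I g]].

Definition vnumber_degree I : set nat :=
  [set d | (1 <= d)%N /\
           exists f p, [/\ f \is d.-homog, Ass I p & colon I f = p]].

Definition is_vnumber I (v : nat) : Prop :=
  (I = irrelevant_ideal /\ v = 0%N) \/
  [/\ I `<` irrelevant_ideal, vnumber_degree I v
    & forall d, vnumber_degree I d -> (v <= d)%N].

End Ideals.

(* Main.v *)
Require Import Defs.
From HB Require Import structures.
From mathcomp Require Import all_boot all_order all_algebra.
From mathcomp Require Import zify mpoly classical_sets.

Import GRing.Theory.

(** The claimed value is the ceiling of n / 6, and it comes from counting
    dominating sets, because for any graph H the v-number of I(H) is governed by
    pairs (A, W) of vertex sets with W independent and every vertex outside W
    adjacent to A.

    Such a pair with A inside W gives a witness: if f is the product of the
    variables of A, then (I(H) : f) is the prime ideal generated by the variables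
    outside W ([vnumber_degree_dominating]).  Conversely, let (I(H) : f) = p be
    prime with f homogeneous of degree d.  The vertices whose variable is in p
    form a vertex cover because p contains I(H), so their complement W is
    independent.  As f is not in I(H), some monomial m of f contains no edge; if
    x_i is in p, then x_i m does contain an edge, which must join i to the
    support A of m, and A has at most d elements ([vnumber_degree_cover]).

    In the square of the n-cycle every vertex has at most 4 neighbours and an
    independent set has at most n / 3 elements, so the pair satisfies
    2n/3 <= n - |W| <= 4 |A| <= 4 d, that is, n <= 6 d.  The bound is attained by
    taking for W the multiples of 3 and for A essentially the multiples
    of 6 ([sixths], [thirds]). *)

(** * Degrees of v-number witnesses of edge ideals *)

Section EdgeIdeals.
Local Open Scope ring_scope.
Local Open Scope classical_set_scope.

Variables (K : fieldType) (n : nat).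
Local Notation S := {mpoly K[n]}.
Implicit Types (f g : S) (m : 'X_{1..n}) (W : {set 'I_n}) (H : sgraph 'I_n).

Lemma idealr_closedP (J : set S) :
  idealr_closed (mem J) <->
  [/\ J 0, ~ J 1 & forall f u v, J u -> J v -> J (f * u + v)].
Proof.
split=> [[J0 J1 JD]|[J0 J1 JD]]; split.
- by rewrite in_setE in J0.
- by move=> J1'; case/negP: J1; rewrite in_setE.
- by move=> f u v Ju Jv; have := JD f u v; rewrite !in_setE; apply.
- by rewrite in_setE.
- by apply/negP; rewrite in_setE.
- by move=> f u v; rewrite !in_setE; apply: JD.
Qed.

Lemma idealr_closedM (J : set S) f g :
  idealr_closed (mem J) -> J g -> J (f * g).
Proof.
by move=> /idealr_closedP[J0 _ JD] Jg; rewrite -[_ * _]addr0; apply: JD.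
Qed.

(** When P is stable under multiples, this is the ideal spanned by the monomials
    whose exponent satisfies P. *)
Definition monomial_ideal (P : pred 'X_{1..n}) : set S :=
  [set g | forall m, m \in msupp g -> P m].

Definition has_edge H : pred 'X_{1..n} :=
  fun m => [exists i, exists j, [&& H i j, (0 < m i)%N & (0 < m j)%N]].

Definition has_outside W : pred 'X_{1..n} :=
  fun m => [exists i, (i \notin W) && (0 < m i)%N].

Lemma has_edgeP H m :
  reflect (exists i j, [/\ H i j, (0 < m i)%N & (0 < m j)%N]) (has_edge H m).
Proof.
apply: (iffP existsP) => [[i /existsP[j /and3P[Hij mi mj]]]|[i [j [Hij mi mj]]]].
  by exists i, j.
by exists i; apply/existsP; exists j; apply/and3P.
Qed.

Lemma has_outsideP W m :
  reflect (exists2 i, i \notin W & (0 < m i)%N) (has_outside W m).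
Proof. exact: exists_inP. Qed.

Lemma has_edgeD H m m' : has_edge H m' -> has_edge H (m + m')%MM.
Proof.
move=> /has_edgeP[i [j [Hij mi mj]]]; apply/has_edgeP; exists i, j.
by rewrite !mnmDE !addn_gt0 mi mj !orbT.
Qed.

Lemma has_outsideD W m m' : has_outside W m' -> has_outside W (m + m')%MM.
Proof.
move=> /has_outsideP[i Wi mi]; apply/has_outsideP; exists i => //.
by rewrite mnmDE addn_gt0 mi orbT.
Qed.

Lemma has_edge0 H : ~~ has_edge H 0%MM.
Proof. by apply/has_edgeP => -[i [j []]]; rewrite mnm0E. Qed.

Lemma has_outside0 W : ~~ has_outside W 0%MM.
Proof. by apply/has_outsideP => -[i _]; rewrite mnm0E. Qed.

Lemma monomial_ideal_closed (P : pred 'X_{1..n}) :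
    ~~ P 0%MM -> (forall m m', P m' -> P (m + m')%MM) ->
  idealr_closed (mem (monomial_ideal P)).
Proof.
move=> P0 PD; apply/idealr_closedP; split=> [m|/(_ 0%MM)|f u v Pu Pv m].
- by rewrite msupp0.
- by rewrite msupp1 inE eqxx => /(_ isT); apply/negP.
move=> /msuppD_le; rewrite mem_cat => /orP[|/Pv//].
by move=> /msuppM_le/allpairsP[[m1 m2] /= [_ /Pu Pm2 ->]]; exact: PD.
Qed.

(** Membership in an edge ideal can be tested one monomial at a time: the
    polynomials all of whose monomials are divisible by an edge form an ideal, and
    each of these monomials is a multiple of a generator. *)
Lemma edge_idealE H : edge_ideal H = monomial_ideal (has_edge H) :> set S.
Proof.
rewrite eqEsubset; split=> [g|g gP J [Jcl sJ]].
  apply; split.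
    by apply: monomial_ideal_closed; [exact: has_edge0|exact: has_edgeD].
  move=> _ [i [j [Hij ->]]] m; rewrite -mpolyXD msuppX inE => /eqP->.
  by apply/has_edgeP; exists i, j; rewrite !mnmDE !mnm1E !eqxx !addn_gt0 orbT.
rewrite (mpolyE g) big_seq; elim/big_ind: _ => [|u v Ju Jv|m /gP].
- by case/idealr_closedP: Jcl.
- by case/idealr_closedP: Jcl => _ _ JD; rewrite -[u]mul1r; apply: JD.
move=> /has_edgeP[i [j [Hij mi mj]]].
(* As i and j differ, subtracting U_(i) and then U_(j) never truncates. *)
have neq_ij : i != j by apply: contraTneq Hij => ->; rewrite (adj_irr H).
have -> : 'X_[m] = 'X_[(m - U_(i) - U_(j))%MM] * ('X_i * 'X_j) :> S.
  rewrite -!mpolyXD; congr 'X_[_]; apply/mnmP => k.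
  rewrite !mnmDE !mnmBE !mnm1E.
  case: (eqVneq i k) => [ik|_]; case: (eqVneq j k) => [jk|_]; last lia.
  - by rewrite ik jk eqxx in neq_ij.
  - by subst k; lia.
  - by subst k; lia.
by rewrite scalerAl; apply: idealr_closedM => //; apply: sJ; exists i, j.
Qed.

(** The ideal is the kernel of the substitution that sends the variables outside W
    to 0 and fixes the others, and the target of this morphism is a domain. *)
Lemma outside_ideal_prime W :
  prime_idealr_closed (mem (monomial_ideal (has_outside W))).
Proof.
pose phi g := g \mPo [tuple if i \in W then 'X_i else 0 : S | i < n].
have phiX m : phi 'X_[m] = if has_outside W m then 0 else 'X_[m].
  rewrite /phi comp_mpolyX; case: has_outsideP => [[i Wi mi]|Wm].
    by rewrite (bigD1 i) //= tnth_mktuple (negPf Wi) expr0n gtn_eqF // mul0r.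
  rewrite mpolyXE_id; apply: eq_bigr => i _; rewrite tnth_mktuple.
  case: ifP => // /negbT Wi; case: (posnP (m i)) => [->|mi]; first by rewrite !expr0.
  by case: Wm; exists i.
have kerphi g : (g \in mem (monomial_ideal (has_outside W))) = (phi g == 0).
  apply/idP/eqP; rewrite in_setE; [move=> gW|move=> phig m mg].
    rewrite /phi comp_mpolyEX big_seq big1 // => m /gW Wm.
    by have := phiX m; rewrite Wm /phi => ->; rewrite scaler0.
  case: (boolP (has_outside W m)) => // Wm; have := congr1 (mcoeff m) phig.
  rewrite /phi comp_mpolyEX raddf_sum mcoeff0 (bigD1_seq m) ?msupp_uniq //=.
  rewrite big1 => [|m' ne_m'm]; last first.
    rewrite mcoeffZ [_ \mPo _]phiX.
    by case: ifP; rewrite ?mcoeff0 ?mcoeffX ?(negPf ne_m'm) mulr0.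
  rewrite mcoeffZ [_ \mPo _]phiX (negPf Wm) mcoeffX eqxx mulr1 addr0.
  by move=> /eqP; rewrite mcoeff_eq0 mg.
by move=> u v; rewrite !kerphi /phi rmorphM /= mulf_eq0.
Qed.

(** Multiplication by a monomial translates the support, so it is enough to decide
    when m + m' contains an edge.  An edge of m + m' leaves W since W is
    independent, and its end outside W can only come from m'.  In the other
    direction a variable of m' outside W forms an edge with a variable of m. *)
Lemma colon_edge_ideal_dominating H m W :
    (forall i, (0 < m i)%N -> i \in W) -> {in W &, forall i j, ~~ H i j} ->
    (forall i, i \notin W -> exists2 a, (0 < m a)%N & H i a) ->
  colon (edge_ideal H) 'X_[m] = monomial_ideal (has_outside W) :> set S.
Proof.
move=> mW indW dom; rewrite edge_idealE eqEsubset.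
have suppE g m' : ((m + m')%MM \in msupp (g * 'X_[m])) = (m' \in msupp g).
  by rewrite (perm_mem (msuppMX _ _)) mem_map // => ? ?; apply: addmI.
split=> g gP m' => [m'g|].
  have /has_edgeP[i [j [Hij]]] : has_edge H (m + m')%MM by apply: gP; rewrite suppE.
  have Wm' k : k \notin W -> (0 < (m + m')%MM k)%N -> has_outside W m'.
    move=> Wk; rewrite mnmDE addn_gt0 => /orP[/mW kW|m'k]; first by rewrite kW in Wk.
    by apply/has_outsideP; exists k.
  case: (boolP (i \in W)) => [iW _|Wi /(Wm' _ Wi)//].
  case: (boolP (j \in W)) => [jW _|Wj /(Wm' _ Wj)//].
  by move: (indW i j iW jW); rewrite Hij.
rewrite (perm_mem (msuppMX _ _)) => /mapP[m'' /gP/has_outsideP[i /dom[a ma Hia] mi] ->].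
apply/has_edgeP; exists i, a; split => //.
  by rewrite mnmDE addn_gt0 mi orbT.
by rewrite mnmDE addn_gt0 ma.
Qed.

(** The dominating vertices are a family indexed by 'I_d rather than a set, so that
    repetitions are allowed and the product of their variables has degree d
    without any count of distinct values. *)
Lemma vnumber_degree_dominating H d (a : 'I_d -> 'I_n) W :
    (0 < d)%N -> (forall k, a k \in W) -> {in W &, forall i j, ~~ H i j} ->
    (forall i, i \notin W -> exists k, H i (a k)) ->
  vnumber_degree (edge_ideal H : set S) d.
Proof.
move=> d_gt0 aW indW dom; pose m := (\sum_k U_(a k))%MM : 'X_{1..n}.
have mE i : (0 < m i)%N = [exists k, a k == i].
  rewrite /m mnm_sumE lt0n sum_nat_eq0 negb_forall.
  by apply: eq_existsb => k; rewrite mnm1E eqb0 negbK.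
have colE : colon (edge_ideal H) 'X_[m] = monomial_ideal (has_outside W) :> set S.
  apply: colon_edge_ideal_dominating => // [i|i /dom[k Hik]].
    by rewrite mE => /existsP[k /eqP <-].
  by exists (a k) => //; rewrite mE; apply/existsP; exists k.
split=> //; exists 'X_[m], (monomial_ideal (has_outside W)); split=> //.
- apply/dhomogP => m'; rewrite msuppX inE => /eqP->.
  by rewrite /m /= mdeg_sum (eq_bigr (fun=> 1%N)) ?sum1_card ?card_ord // => k _; rewrite mdeg1.
- split; last by exists 'X_[m].
    by apply: monomial_ideal_closed; [exact: has_outside0|exact: has_outsideD].
  exact: outside_ideal_prime.
Qed.

(** The set A is the support of a monomial of f outside the edge ideal, and W is the
    complement of the vertex cover cut out by the prime (I : f). *)
Lemma vnumber_degree_cover H d :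
    vnumber_degree (edge_ideal H : set S) d ->
  exists A W : {set 'I_n}, [/\ (#|A| <= d)%N, {in W &, forall i j, ~~ H i j}
    & forall i, i \notin W -> exists2 a, a \in A & H i a].
Proof.
move=> [_ [f [p [fd [pcl ppr _] colf]]]].
have Ip g : (g \in mem p) <-> edge_ideal H (g * f) by rewrite in_setE -colf.
have /allPn[m mf mE] : ~~ all (has_edge H) (msupp f).
  apply/negP => /allP fE; case: pcl => _ /negP[].
  by apply/Ip; rewrite mul1r edge_idealE.
exists [set i | (0 < m i)%N]%SET, [set i | 'X_i \notin mem p]%SET; split.
- rewrite -(dhomog_mf fd mf) /= mdegE -sum1_card big_mkcond; apply: leq_sum => i _.
  by rewrite inE; case: (m i).
- move=> i j; rewrite 2!inE => pi pj; apply/negP => Hij.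
  suff /ppr : 'X_i * 'X_j \in mem p by rewrite (negPf pi) (negPf pj).
  apply/Ip; rewrite mulrC => J [Jcl sJ].
  by apply: idealr_closedM => //; apply: sJ; exists i, j.
move=> i; rewrite inE negbK => /Ip; rewrite edge_idealE mulrC.
move=> /(_ (U_(i) + m)%MM); rewrite (perm_mem (msuppMX _ _)) map_f //.
move=> /(_ isT)/has_edgeP[b [c [Hbc]]].
rewrite !mnmDE !mnm1E => mb mc.
(* The edge bc of x_i m must use i, since m has no edge of its own. *)
have Hcb : H c b by rewrite (adj_sym H).
have ne_bc : b != c by apply: contraTneq Hbc => ->; rewrite (adj_irr H).
case: (eqVneq i b) mb => [ib _|_ /= mb].
  subst b; exists c; rewrite ?inE //.
  by move: mc; rewrite (negPf ne_bc).
case: (eqVneq i c) mc => [->|_ /= mc]; first by exists b; rewrite ?inE.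
by case/negP: mE; apply/has_edgeP; exists b, c.
Qed.

Lemma edge_ideal_proper H : (0 < n)%N ->
  (edge_ideal H : set S) `<` @irrelevant_ideal K n.
Proof.
move=> n_gt0; rewrite properEneq; split; last first.
  move=> g Ig J [Jcl sJ]; apply: Ig; split=> // _ [i [j [_ ->]]].
  by apply: idealr_closedM => //; apply: sJ; exists j.
apply/eqP => IE.
have : @irrelevant_ideal K n 'X_(Ordinal n_gt0) by move=> J [_]; apply; exists (Ordinal n_gt0).
rewrite -IE edge_idealE => /(_ U_(Ordinal n_gt0)%MM).
rewrite msuppX inE eqxx => /(_ isT)/has_edgeP[i [j [Hij]]].
rewrite !mnm1E !lt0b => /eqP ei /eqP ej.
by move: Hij; rewrite -ei -ej (adj_irr H).
Qed.

End EdgeIdeals.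

(** * Independence and domination in squares of cycles *)

Section CycleSquares.

Variables (n : nat).
Hypothesis n_ge3 : 2 < n.
Implicit Types (i j : 'I_n) (A W : {set 'I_n}).
Local Notation C2 := (square (cycle_graph n)).

Lemma ordS_neq i : ordS i != i.
Proof.
apply/eqP => /(congr1 val) /=; have := ltn_ord i.
have [lt_i1n|le_ni1] := ltnP i.+1 n; first by rewrite modn_small //; lia.
by move=> lt_in; have -> : i.+1 = n; [lia|rewrite modnn; lia].
Qed.

Lemma ordSS_val i : val (ordS (ordS i)) = i.+2 %% n.
Proof. by rewrite /= -addn1 modnDml addn1. Qed.

Lemma ordSS_neq i : ordS (ordS i) != i.
Proof.
apply/eqP => /(congr1 val); rewrite ordSS_val /=; have lt_in := ltn_ord i.
have [lt_i2n|le_ni2] := ltnP i.+2 n; first by rewrite modn_small //; lia.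
have -> : i.+2 = n + (i.+2 - n) by lia.
by rewrite modnDl modn_small; lia.
Qed.

(** In a walk with two steps, a step forward and a step back cancel out, which leaves
    only double steps in one direction. *)
Lemma square_cycleP i j :
  reflect (i != j /\ [\/ j = ordS i, i = ordS j, j = ordS (ordS i) | i = ordS (ordS j)])
          (C2 i j).
Proof.
have stepE x y : cycle_graph n x y = (y == ordS x) || (x == ordS y).
  rewrite /= /cycle_adj /=; case: (eqVneq x y) => //= <-.
  by rewrite eq_sym (negPf (ordS_neq x)).
have dist1 x y z : cycle_graph n x z -> cycle_graph n z y -> dist_le (cycle_graph n) 2 x y.
  by move=> xz zy; apply/dist_leP; exists [:: z; y]; split=> //; apply/and3P.
apply: (iffP andP) => -[neq_ij].
  move=> /dist_leP[p [pathp lastp size_p]]; split=> //.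
  case: p size_p pathp lastp => [_ _ /= eq_ij|x [|y [|//]]].
  - by rewrite eq_ij eqxx in neq_ij.
  - move=> _ /andP[ix _] /= xj; move: ix; rewrite xj stepE => /orP[]/eqP ?; [exact: Or41|exact: Or42].
  move=> _ /and3P[ix xy _] /= yj; move: ix xy; rewrite yj !stepE => /orP[]/eqP xE /orP[]/eqP yE.
  - by apply: Or43; rewrite yE xE.
  - by rewrite (ordS_inj (etrans (esym xE) yE)) eqxx in neq_ij.
  - by rewrite yE xE eqxx in neq_ij.
  - by apply: Or44; rewrite xE yE.
move=> adj_ij; split=> //; case: adj_ij => [->|->|->|->].
- by apply/dist_leP; exists [:: ordS i]; split=> //; apply/andP; rewrite stepE eqxx.
- by apply/dist_leP; exists [:: j]; split=> //; apply/andP; rewrite stepE eqxx orbT.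
- by apply: (dist1 _ _ (ordS i)); rewrite stepE eqxx.
- by apply: (dist1 _ _ (ordS j)); rewrite stepE eqxx orbT.
Qed.

Lemma square_cycle_sym i j : C2 i j = C2 j i.
Proof. exact: adj_sym. Qed.

Lemma square_cycle_near i j : i < j <= i + 2 -> C2 i j.
Proof.
move=> /andP[lt_ij le_ji]; have lt_jn := ltn_ord j; apply/square_cycleP; split.
  by rewrite neq_ltn lt_ij.
have [eq_j|ne_j] := eqVneq (val j) i.+1.
  by apply/Or41/val_inj; rewrite /= modn_small -eq_j.
have eq_j : val j = i.+2 by move: ne_j => /=; lia.
by apply/Or43/val_inj; rewrite ordSS_val modn_small -eq_j.
Qed.

Lemma square_cycle_wrap i j : val j = 0 -> n - 2 <= i -> C2 i j.
Proof.
move=> j0 le_i; have lt_in := ltn_ord i; apply/square_cycleP; split.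
  by apply/eqP => /(congr1 val); rewrite j0 /=; lia.
have [eq_i|ne_i] := eqVneq i.+1 n.
  by apply/Or41/val_inj; rewrite j0 /= eq_i modnn.
have eq_i : i.+2 = n by lia.
by apply/Or43/val_inj; rewrite j0 ordSS_val eq_i modnn.
Qed.

(** The translates of W by 0, 1 and 2 are pairwise disjoint.  The assumption that n
    is at least 3 makes i, i + 1 and i + 2 distinct modulo n. *)
Lemma card_independent_square_cycle W :
  {in W &, forall i j, ~~ C2 i j} -> 3 * #|W| <= n.
Proof.
move=> indW; pose S1 := @ordS n @: W; pose S2 := @ordS n @: S1.
have dis A (B : {set 'I_n}) :
    (forall i, i \in A -> i \in B -> False) -> #|A :|: B| = #|A| + #|B|.
  move=> AB; rewrite cardsU disjoint_setI0 ?cards0 ?subn0 // disjoint_subset.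
  by apply/fintype.subsetP => i iA; apply/negP; apply: AB.
have cS A : #|@ordS n @: A| = #|A| by apply: card_imset; apply: ordS_inj.
have : #|W :|: (S1 :|: S2)| <= n by rewrite -[n in _ <= n]card_ord max_card.
rewrite !dis ?cS; first by lia.
- move=> _ /imsetP[i iW ->] /imsetP[_ /imsetP[j jW ->]] /ordS_inj ij.
  have /negP[] := indW j i jW iW; apply/square_cycleP; rewrite ij eq_sym ordS_neq.
  by split=> //; apply: Or41.
move=> i iW /setUP[/imsetP[j jW ij]|/imsetP[_ /imsetP[j jW ->] ij]];
  have /negP[] := indW j i jW iW; apply/square_cycleP; rewrite ij.
  by rewrite eq_sym ordS_neq; split=> //; apply: Or41.
by rewrite eq_sym ordSS_neq; split=> //; apply: Or43.
Qed.

(** The complement of W is contained in the four translates of A by -1, -2, 1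
    and 2. *)
Lemma card_dominated_square_cycle A W :
  (forall i, i \notin W -> exists2 a, a \in A & C2 i a) -> n - #|W| <= 4 * #|A|.
Proof.
move=> dom; pose pA := @ord_pred n @: A; pose sA := @ordS n @: A.
have sub : ~: W \subset (pA :|: @ord_pred n @: pA) :|: (sA :|: @ordS n @: sA).
  apply/fintype.subsetP => i; rewrite inE => /dom[a aA /square_cycleP[_]].
  have pa : ord_pred a \in pA by apply: imset_f.
  have sa : ordS a \in sA by apply: imset_f.
  rewrite !finset.in_setU; case=> [ai|->|ai|->].
  - have -> : i = ord_pred a by rewrite ai ordSK.
    by rewrite pa.
  - by rewrite sa !orbT.
  - have -> : i = ord_pred (ord_pred a) by rewrite ai !ordSK.
    by rewrite (imset_f _ pa) !orbT.
  - by rewrite (imset_f _ sa) !orbT.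
have {sub} := subset_leq_card sub.
rewrite cardsCs finset.setCK card_ord => /leq_trans; apply.
have cim (f : 'I_n -> 'I_n) (B : {set 'I_n}) : #|f @: B| <= #|B|.
  exact: leq_imset_card.
have cU (B C : {set 'I_n}) : #|B :|: C| <= #|B| + #|C| by rewrite leq_card_setU.
have -> : 4 * #|A| = #|A| + #|A| + (#|A| + #|A|) by lia.
apply: leq_trans (cU _ _) _; apply: leq_add; apply: leq_trans (cU _ _) _; apply: leq_add;
  by [apply: cim | apply: leq_trans (cim _ _) (cim _ _)].
Qed.

(** * The extremal configuration *)

Lemma sixths_subproof (k : 'I_((n + 5) %/ 6)) : minn (6 * k) (3 * (n %/ 3).-1) < n.
Proof. by have := ltn_ord k; lia. Qed.

(** There are ceil(n / 6) multiples of 6 below n, but if n is 1 or 2 modulo 6 the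
    last one is adjacent to 0 across the end of the cycle; capping at the largest
    element 3 (n / 3 - 1) of [thirds] moves it back by 3. *)
Definition sixths k : 'I_n := Ordinal (sixths_subproof k).

(** The bound i + 3 <= n keeps the last multiple of 3 at distance at least 3
    from 0 around the cycle. *)
Definition thirds : {set 'I_n} := [set i : 'I_n | (3 %| i) && (i + 3 <= n)].

Lemma sixths_thirds k : sixths k \in thirds.
Proof. rewrite inE /=; lia. Qed.

Lemma thirds_independent : {in thirds &, forall i j, ~~ C2 i j}.
Proof.
have S1 i j : i \in thirds -> j \in thirds -> j <> ordS i.
  rewrite !inE => /andP[i3 i_lt] /andP[j3 _] /(congr1 val) /=.
  by rewrite modn_small; lia.
have S2 i j : i \in thirds -> j \in thirds -> j <> ordS (ordS i).
  rewrite !inE => /andP[i3 i_lt] /andP[j3 _] /(congr1 val); rewrite ordSS_val /=.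
  by rewrite modn_small; lia.
move=> i j iU jU; apply/square_cycleP => -[_ []].
- exact: S1.
- exact: S1.
- exact: S2.
- exact: S2.
Qed.

(** The last two vertices are adjacent to 0.  Any other vertex i outside [thirds] is
    strictly between 3 q and 3 q + 3 with q = i / 3, at distance at most 2 from
    both; the even one of q and q + 1 gives a multiple of 6, and if that exceeds
    the cap then the cap is 3 q. *)
Lemma thirds_dominated i : i \notin thirds -> exists k, C2 i (sixths k).
Proof.
have lt_in := ltn_ord i; rewrite inE => iU.
have [lt_i2n|le_ni2] := ltnP i (n - 2); last first.
  have k_lt : 0 < (n + 5) %/ 6 by lia.
  by exists (Ordinal k_lt); apply: square_cycle_wrap => //=; rewrite min0n.
(* Twice this index is the even one of q and q + 1. *)
have k_lt : (i %/ 3).+1 %/ 2 < (n + 5) %/ 6 by lia.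
exists (Ordinal k_lt); have [near|near] := ltnP i (sixths (Ordinal k_lt)).
  by apply: square_cycle_near; rewrite near /=; lia.
by rewrite square_cycle_sym; apply: square_cycle_near; move: near => /=; lia.
Qed.

End CycleSquares.

Theorem corollary4p5 (K : fieldType) (n : nat) (hn : (3 <= n)%N) :
  exists v : nat,
    is_vnumber (@edge_ideal K n (square (cycle_graph n))) v /\
    (v%:Z = if (n %% 6 == 0)%N || (n %% 6 == 5)%N
            then ((n%:Z - 5%:Z) %/ 6)%Z + 1
            else ((n%:Z - 5%:Z) %/ 6)%Z + 2)%R.
Proof.
exists ((n + 5) %/ 6); split; last by case: ifP => n_mod6; lia.
right; split; first by apply: edge_ideal_proper; lia.
  apply: (@vnumber_degree_dominating _ _ _ _ (@sixths n hn) (thirds n)); first lia.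
  - exact: sixths_thirds.
  - exact: thirds_independent.
  - exact: thirds_dominated.
move=> d /vnumber_degree_cover[A [W [leAd indW dom]]].
have := card_independent_square_cycle _ hn _ indW.
have := card_dominated_square_cycle _ hn _ _ dom.
lia.
Qed.
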